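(* Let $S_A=V(A_h,\ qs-r^2)\subset\mathbb{C}^4$ with $A_h=256-192p+48p^2-4p^3-128q-80pq+p^2q+16q^2+288r+36pr-8qr-108s$ (coordinates $(p,q,r,s)$), and let $S_C=V(ac-b^2)\subset\mathbb{C}^3$ be the affine quadric cone (coordinates $(a,b,c)$). Then $S_A$ is birationally equivalent to $S_C$.
   Context: $S_A$ (the ''astroid surface'') is an irreducible affine algebraic surface. Birational equivalence means the existence of mutually inverse rational maps between the two irreducible varieties over $\mathbb{C}$. *)

(* Defs.v *)
From HB Require Import structures.
From mathcomp Require Import all_boot all_order all_algebra.
From mathcomp Require Import mpoly complex reals.

Set Implicit Arguments.
Unset Strict Implicit.
Unset Printing Implicit Defensive.

Import GRing.Theory.
Local Open Scope ring_scope.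

(* Points of affine n-space are finite functions, K ^ n := {ffun 'I_n -> K}. *)

Section AffineVarieties.
Variables (K : fieldType) (n : nat).

(* Finite systems of equations suffice to describe all Zariski-closed sets, by
   the Hilbert basis theorem. *)
Definition zero_locus (F : seq {mpoly K[n]}) (x : K ^ n) : Prop :=
  forall f, f \in F -> f.@[x] = 0.

Definition algebraic_set (V : K ^ n -> Prop) : Prop :=
  exists F, forall x, V x <-> zero_locus F x.

Definition irreducible_variety (V : K ^ n -> Prop) : Prop :=
  [/\ algebraic_set V, exists x, V x &
      forall F G,
        (forall x, V x -> zero_locus F x \/ zero_locus G x) ->
        (forall x, V x -> zero_locus F x) \/ (forall x, V x -> zero_locus G x)].

(* P holds on a nonempty relatively Zariski-open subset of V, which is dense
   when V is irreducible. *)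
Definition generically (V P : K ^ n -> Prop) : Prop :=
  exists2 F, exists2 x, V x & ~ zero_locus F x &
             forall x, V x -> ~ zero_locus F x -> P x.

(* The quotient num / den; it represents a rational function on V as soon as
   den does not vanish identically on V. *)
Record rational_fraction := RationalFraction {
  num : {mpoly K[n]};
  den : {mpoly K[n]}
}.

Definition fraction_defined (r : rational_fraction) (x : K ^ n) : Prop :=
  (den r).@[x] <> 0.

Definition fraction_value (r : rational_fraction) (x : K ^ n) : K :=
  (num r).@[x] / (den r).@[x].

End AffineVarieties.

Section RationalMaps.
Variable K : fieldType.

Definition fraction_tuple (n m : nat) := 'I_m -> rational_fraction K n.

Definition map_defined n m (phi : fraction_tuple n m) (x : K ^ n) : Prop :=
  forall i, fraction_defined (phi i) x.

Definition map_value n m (phi : fraction_tuple n m) (x : K ^ n) : K ^ m :=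
  [ffun i => fraction_value (phi i) x].

Definition rational_map n m (V : K ^ n -> Prop) (W : K ^ m -> Prop)
    (phi : fraction_tuple n m) : Prop :=
  generically V (map_defined phi) /\
  forall x, V x -> map_defined phi x -> W (map_value phi x).

(* psi \o phi is defined and equal to the identity as a rational map on V;
   rational maps are equal when they agree on a nonempty open subset. *)
Definition rational_left_inverse n m (V : K ^ n -> Prop)
    (phi : fraction_tuple n m) (psi : fraction_tuple m n) : Prop :=
  generically V (fun x => [/\ map_defined phi x,
                              map_defined psi (map_value phi x) &
                              map_value psi (map_value phi x) = x]).

Definition birationally_equivalent n m
    (V : K ^ n -> Prop) (W : K ^ m -> Prop) : Prop :=
  [/\ irreducible_variety V, irreducible_variety W &
      exists (phi : fraction_tuple n m) (psi : fraction_tuple m n),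
        [/\ rational_map V W phi, rational_map W V psi,
            rational_left_inverse V phi psi &
            rational_left_inverse W psi phi]].

End RationalMaps.

Section AstroidSurface.
Variable K : fieldType.

Definition astroid_poly : {mpoly K[4]} :=
  let p := 'X_(0 : 'I_4) in let q := 'X_(1 : 'I_4) in
  let r := 'X_(2 : 'I_4) in let s := 'X_(3 : 'I_4) in
  256 - 192 * p + 48 * p ^+ 2 - 4 * p ^+ 3 - 128 * q - 80 * p * q
  + p ^+ 2 * q + 16 * q ^+ 2 + 288 * r + 36 * p * r - 8 * q * r - 108 * s.

Definition astroid_surface : K ^ 4 -> Prop :=
  let q := 'X_(1 : 'I_4) in
  let r := 'X_(2 : 'I_4) in let s := 'X_(3 : 'I_4) in
  zero_locus [:: astroid_poly; q * s - r ^+ 2].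

Definition quadric_cone : K ^ 3 -> Prop :=
  let a := 'X_(0 : 'I_3) in let b := 'X_(1 : 'I_3) in
  let c := 'X_(2 : 'I_3) in
  zero_locus [:: a * c - b ^+ 2].

End AstroidSurface.

Arguments astroid_surface K : clear implicits.
Arguments quadric_cone K : clear implicits.

(* Main.v *)
(** Put [u = 4 - p] and [w = r / q - 2]. Eliminating [s] through [q s = r^2]
    turns [A_h = 0] into the homogeneous equation
    [4 u^3 + q u^2 - 36 q u w - 108 q w^2 - 8 q^2 w = 0], the cone over a
    cuspidal plane cubic. Parametrising that cubic by
    [(u : q : w) = (2 y (2 + 3 y) : 2 : y^2 (1 + 2 y))] and setting
    [(a, b, c) = (c y^2, c y, c)] with [c = q / 2], all of [p], [q], [r], [s] become polynomials
    in [a], [b], [c]. The resulting polynomial map from the quadric cone to the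
    astroid surface is onto, and has a rational inverse since
    [y = (u + 18 w) / (2 (q + 3 u))]. Irreducibility passes from the plane
    to the quadric cone through [(x, y) |-> (x^2, x y, y^2)], and from the cone
    to the astroid surface. *)
Require Import Defs.
From mathcomp Require Import all_boot all_order all_algebra.
From mathcomp Require Import mpoly complex reals.
From mathcomp Require Import boolp ring.

Set Implicit Arguments.
Unset Strict Implicit.
Unset Printing Implicit Defensive.

Import GRing.Theory Num.Theory.
Local Open Scope ring_scope.

(** * Irreducibility of affine space *)

(** In characteristic zero the numerals below [size p] are distinct, one root more than the degree
    of a nonzero [p] allows. *)
Lemma poly_eq0_horner (K : numDomainType) (p : {poly K}) :
  (forall x, p.[x] = 0) -> p = 0.
Proof.
move=> p0; apply: (@roots_geq_poly_eq0 _ _ [seq i%:R | i <- iota 0 (size p)]).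
- by apply/allP => x _; apply/rootP.
- by rewrite map_inj_uniq ?iota_uniq// => i j /eqP; rewrite eqr_nat => /eqP.
- by rewrite size_map size_iota.
Qed.

Lemma horner_mmap_polyC (K : fieldType) n (h : 'I_n -> {poly K}) f t :
  (mmap polyC h f).[t] = f.@[fun i => (h i).[t]].
Proof.
rewrite mevalE /mmap horner_sum; apply: eq_bigr => m _.
rewrite hornerM hornerC; congr (_ * _).
by rewrite /mmap1 horner_prod; apply: eq_bigr => i _; rewrite horner_exp.
Qed.

(* If f v != 0 and g w != 0, then f and g restrict to nonzero univariate
   polynomials on the line through v and w. *)
Lemma meval_mul_eq0 (K : numFieldType) n (f g : {mpoly K[n]}) :
  (forall x : K ^ n, f.@[x] * g.@[x] = 0) ->
  (forall x : K ^ n, f.@[x] = 0) \/ (forall x : K ^ n, g.@[x] = 0).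
Proof.
move=> fg0; have [f0|/existsNP[v fv]] := EM (forall x : K ^ n, f.@[x] = 0).
  by left.
right=> w.
pose h i : {poly K} := (v i)%:P + (w i - v i)%:P * 'X.
have hE t i : (h i).[t] = v i + (w i - v i) * t by rewrite !hornerE.
have /eqP : mmap polyC h f * mmap polyC h g = 0.
  apply: poly_eq0_horner => t; rewrite hornerM !horner_mmap_polyC.
  have := fg0 [ffun i => (h i).[t]].
  by rewrite !(meval_eq _ (ffunE _)).
rewrite mulf_eq0 => /orP[] /eqP /(congr1 (fun p => p.[_])) p0.
  case: fv; rewrite -[RHS](horner0 0) -(p0 0) horner_mmap_polyC.
  by apply: meval_eq => i; rewrite hE mulr0 addr0.
rewrite -[RHS](horner0 1) -(p0 1) horner_mmap_polyC.
by apply: meval_eq => i; rewrite hE mulr1 addrC subrK.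
Qed.

(** An [f] in [F] that is nonzero somewhere has [f g = 0] everywhere for each [g] in [G], so every
    such [g] vanishes identically. *)
Lemma irreducible_affine_space (K : numFieldType) n :
  irreducible_variety (fun _ : K ^ n => True).
Proof.
split; [by exists [::] | by exists [ffun=> 0] | move=> F G FG].
have [F0|/existsNP[x /not_implyP[_ Fx]]] :=
  EM (forall x : K ^ n, True -> zero_locus F x); first by left.
right; move: Fx => /existsNP[f /not_implyP[Ff fx]] z _ g Gg.
have fg0 (y : K ^ n) : f.@[y] * g.@[y] = 0.
  by have [/(_ _ Ff)->|/(_ _ Gg)->] := FG y I; rewrite ?mul0r ?mulr0.
by have [f0|->] := meval_mul_eq0 fg0; first by case: fx; apply: f0.
Qed.

(** * Polynomial maps and images of irreducible varieties *)

Section PolynomialMaps.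
Variable K : fieldType.

Lemma algebraic_zero_locus n (F : seq {mpoly K[n]}) : algebraic_set (zero_locus F).
Proof. by exists F. Qed.

Definition poly_map n m (l : m.-tuple {mpoly K[n]}) (y : K ^ n) : K ^ m :=
  [ffun i => (tnth l i).@[y]].

Lemma meval_poly_map n m (l : m.-tuple {mpoly K[n]}) f (y : K ^ n) :
  f.@[poly_map l y] = (f \mPo l).@[y].
Proof. by rewrite comp_mpoly_meval; apply/meval_eq/ffunE. Qed.

Lemma zero_locus_poly_map n m (l : m.-tuple {mpoly K[n]}) F (y : K ^ n) :
  zero_locus F (poly_map l y) <-> zero_locus [seq f \mPo l | f <- F] y.
Proof.
split=> [F0 _ /mapP[f Ff ->]|F0 f Ff]; first by rewrite -meval_poly_map F0.
by rewrite meval_poly_map F0 ?map_f.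
Qed.

(** Closed sets covering [W] pull back to closed sets covering [V]; surjectivity carries the
    containment back to [W]. *)
Lemma irreducible_image n m (l : m.-tuple {mpoly K[n]}) V W :
    irreducible_variety V -> algebraic_set W ->
    (forall y, V y -> W (poly_map l y)) ->
    (forall x, W x -> exists2 y, V y & poly_map l y = x) ->
  irreducible_variety W.
Proof.
move=> [_ [y0 Vy0] irrV] algW VW WV; split=> //.
  by exists (poly_map l y0); apply: VW.
move=> F G FG.
have [|F0|G0] := irrV [seq f \mPo l | f <- F] [seq f \mPo l | f <- G].
- by move=> y Vy; rewrite -!zero_locus_poly_map; apply/FG/VW.
- by left=> x /WV[y Vy <-]; apply/zero_locus_poly_map/F0.
- by right=> x /WV[y Vy <-]; apply/zero_locus_poly_map/G0.
Qed.

Definition poly_fractions n m (l : m.-tuple {mpoly K[n]}) : fraction_tuple K n m :=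
  fun i => RationalFraction (tnth l i) 1.

Lemma map_defined_poly_fractions n m (l : m.-tuple {mpoly K[n]}) x :
  map_defined (poly_fractions l) x.
Proof. by move=> i; rewrite /fraction_defined /= meval1; apply/eqP/oner_neq0. Qed.

Lemma map_value_poly_fractions n m (l : m.-tuple {mpoly K[n]}) x :
  map_value (poly_fractions l) x = poly_map l x.
Proof.
by apply/ffunP => i; rewrite !ffunE /fraction_value /= meval1 divr1.
Qed.

Lemma generically_neq0 n (V P : K ^ n -> Prop) (f : {mpoly K[n]}) x :
    V x -> f.@[x] != 0 -> (forall y, V y -> f.@[y] != 0 -> P y) ->
  generically V P.
Proof.
move=> Vx fx fP; exists [:: f].
  by exists x => // /(_ f); rewrite inE eqxx => /(_ isT) /eqP; apply/negP.
move=> y Vy fy; apply: fP => //; apply/eqP => fy0; apply: fy => g.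
by rewrite inE => /eqP->.
Qed.

(** * Points, equations and maps in coordinates *)

Definition vec n (s : seq K) : K ^ n := [ffun i : 'I_n => s`_i].

Lemma vec3P (x : K ^ 3) : x = vec 3 [:: x 0; x 1; x 2].
Proof.
by apply/ffunP => -[[|[|[|i]]] //= lti]; rewrite ffunE /=; congr (x _); apply/val_inj.
Qed.

Lemma vec4P (x : K ^ 4) : x = vec 4 [:: x 0; x 1; x 2; x 3].
Proof.
by apply/ffunP => -[[|[|[|[|i]]]] //= lti]; rewrite ffunE /=; congr (x _); apply/val_inj.
Qed.

Lemma meval_nat n (v : 'I_n -> K) k : (k%:R : {mpoly K[n]}).@[v] = k%:R.
Proof. exact: rmorph_nat. Qed.

Lemma meval_exp n (v : 'I_n -> K) f k : (f ^+ k).@[v] = f.@[v] ^+ k.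
Proof. exact: rmorphXn. Qed.

(* Numerals come first: the additive rules would unify with an unfolded
   [256%:R]. *)
Definition meval_simp := (meval_nat, meval1, mevalXU, meval_exp, mevalM, mevalB, mevalD, mevalN,
  ffunE).

Lemma astroid_surfaceP (p q r s : K) :
  astroid_surface K (vec 4 [:: p; q; r; s]) <->
    256 - 192 * p + 48 * p ^+ 2 - 4 * p ^+ 3 - 128 * q - 80 * p * q
    + p ^+ 2 * q + 16 * q ^+ 2 + 288 * r + 36 * p * r - 8 * q * r - 108 * s = 0
  /\ q * s = r ^+ 2.
Proof.
rewrite /astroid_surface /zero_locus; split=> [h|[h1 h2] f].
  split.
    by have := h _ (mem_head _ _); rewrite /astroid_poly !meval_simp.
  apply/eqP; rewrite -subr_eq0; apply/eqP.
  by have := h _ (mem_last _ _); rewrite !meval_simp.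
rewrite !inE => /orP[]/eqP->; first by rewrite /astroid_poly !meval_simp.
by rewrite !meval_simp /= h2 subrr.
Qed.

Lemma quadric_coneP (a b c : K) :
  quadric_cone K (vec 3 [:: a; b; c]) <-> a * c = b ^+ 2.
Proof.
rewrite /quadric_cone /zero_locus; split=> [/(_ _ (mem_head _ _))|h f].
  by rewrite !meval_simp => /eqP; rewrite subr_eq0 => /eqP.
by rewrite inE => /eqP->; rewrite !meval_simp /= h subrr.
Qed.

Definition squares : 3.-tuple {mpoly K[2]} :=
  [tuple 'X_(0 : 'I_2) ^+ 2; 'X_(0 : 'I_2) * 'X_(1 : 'I_2); 'X_(1 : 'I_2) ^+ 2].

Lemma poly_map_squares (x : K ^ 2) :
  poly_map squares x = vec 3 [:: x 0 ^+ 2; x 0 * x 1; x 1 ^+ 2].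
Proof.
by apply/ffunP => -[[|[|[|i]]] //= lti]; rewrite !ffunE /tnth /= !meval_simp.
Qed.

(** The last two entries are [q (w + 2)] and [q (w + 2)^2]: on the cone with [c != 0],
    [q w = 2 b^2 + 4 a b] and [q w^2 = 2 a (2 a + b)^2]. *)
Definition astroid_of_cone : 4.-tuple {mpoly K[3]} :=
  let a := 'X_(0 : 'I_3) in let b := 'X_(1 : 'I_3) in let c := 'X_(2 : 'I_3) in
  [tuple 4 - 6 * a - 4 * b; 2 * c; 2 * b ^+ 2 + 4 * a * b + 4 * c;
         2 * a * (2 * a + b) ^+ 2 + 8 * b ^+ 2 + 16 * a * b + 8 * c].

Lemma poly_map_astroid_of_cone (a b c : K) :
  poly_map astroid_of_cone (vec 3 [:: a; b; c]) =
  vec 4 [:: 4 - 6 * a - 4 * b; 2 * c; 2 * b ^+ 2 + 4 * a * b + 4 * c;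
         2 * a * (2 * a + b) ^+ 2 + 8 * b ^+ 2 + 16 * a * b + 8 * c].
Proof.
by apply/ffunP => -[[|[|[|[|i]]]] //= lti]; rewrite !ffunE /tnth /= !meval_simp.
Qed.

(** Here [E = q (u + 18 w)] and [N = q + 3 u], so [y = E / (2 q N)]; the entries are [c y^2], [c y],
    [c] with [c = q / 2]. *)
Definition cone_of_astroid : fraction_tuple K 4 3 :=
  let p := 'X_(0 : 'I_4) in let q := 'X_(1 : 'I_4) in let r := 'X_(2 : 'I_4) in
  let E := q * (4 - p) + 18 * (r - 2 * q) in let N := q + 12 - 3 * p in
  tnth [tuple RationalFraction (E ^+ 2) (8 * q * N ^+ 2);
              RationalFraction E (4 * N); RationalFraction q 2].

Lemma map_value_cone_of_astroid (p q r s : K) :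
  let E := q * (4 - p) + 18 * (r - 2 * q) in let N := q + 12 - 3 * p in
  map_value cone_of_astroid (vec 4 [:: p; q; r; s]) =
  vec 3 [:: E ^+ 2 / (8 * q * N ^+ 2); E / (4 * N); q / 2].
Proof.
move=> E N; apply/ffunP => -[[|[|[|i]]] //= lti];
by rewrite !ffunE /fraction_value /cone_of_astroid /tnth /= !meval_simp.
Qed.

End PolynomialMaps.

(** * The maps between the cone and the astroid surface *)

Section Birational.
Variable K : numFieldType.

(** Both equations pull back to explicit multiples of [a * c - b ^+ 2]. *)
Lemma astroid_of_cone_surface (y : K ^ 3) :
  quadric_cone K y -> astroid_surface K (poly_map (astroid_of_cone K) y).
Proof.
rewrite [y]vec3P; move: (y 0) (y 1) (y 2) => a b c /quadric_coneP cone.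
rewrite poly_map_astroid_of_cone; apply/astroid_surfaceP; split.
  transitivity ((72 * a + 32 * b) * (a * c - b ^+ 2)); first by ring.
  by rewrite cone subrr mulr0.
apply/eqP; rewrite -subr_eq0; apply/eqP.
transitivity (4 * (2 * a + b) ^+ 2 * (a * c - b ^+ 2)); first by ring.
by rewrite cone subrr mulr0.
Qed.

(** [D] stands for [q w], so the hypothesis is the cuspidal cubic multiplied by [q]. *)
Lemma cuspidal_cubic_parameter (p q r : K) :
    q != 0 ->
    let u := 4 - p in let D := r - 2 * q in
    4 * q * u ^+ 3 + q ^+ 2 * u ^+ 2 - 36 * q * u * D - 108 * D ^+ 2
      - 8 * q ^+ 2 * D = 0 ->
  exists y, u = q * (3 * y ^+ 2 + 2 * y)
         /\ D = q ^+ 2 / 2 * (y ^+ 2 + 2 * y ^+ 3).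
Proof.
move=> q0 u D; move: u D => u D.
(* The formula for [y] breaks down only at the cusp, [y = -1/3]. There the cubic reduces to
   [-(q^2 - 54 D)^2 / 27], forcing [D = q^2 / 54]. *)
have [/eqP N0|N0] := boolP (q + 3 * u == 0) => cubic.
  have uE : u = - q / 3.
    by apply/eqP; rewrite -subr_eq0 -(mulr0 3^-1) -N0; apply/eqP; field.
  exists (- 3^-1); split; first by rewrite uE; field.
  have /eqP : (q ^+ 2 - 54 * D) ^+ 2 = 0.
    by rewrite -(mulr0 (- 27)) -cubic uE; field.
  rewrite expf_eq0 /= subr_eq0 => /eqP DE.
  have -> : D = (54 * D) / 54 by field.
  by rewrite -DE; field.
(* Away from the cusp, both sides of each identity differ by an explicit multiple of the cubic. *)
exists ((q * u + 18 * D) / (2 * q * (q + 3 * u))).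
split; apply/eqP; rewrite -subr_eq0; apply/eqP.
  rewrite -(mulr0 (9 / (4 * q * (q + 3 * u) ^+ 2))) -cubic.
  by field; rewrite q0 N0.
rewrite -(mulr0 ((54 * D - q ^+ 2) / (8 * q * (q + 3 * u) ^+ 3))) -cubic.
by field; rewrite q0 N0.
Qed.

Lemma astroid_of_cone_onto (x : K ^ 4) :
    astroid_surface K x ->
  exists2 y, quadric_cone K y & poly_map (astroid_of_cone K) y = x.
Proof.
rewrite [x]vec4P; move: (x 0) (x 1) (x 2) (x 3) => p q r s /astroid_surfaceP[].
have [-> A0 /eqP|q0 A0 qs] := eqVneq q 0.
  rewrite mul0r eq_sym expf_eq0 /= => /eqP r0; rewrite r0 in A0 *.
  (* Over [q = 0] the surface is the curve [r = 0], [4 (4 - p)^3 = 108 s], the image of the line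
     [b = c = 0]. *)
  exists (vec 3 [:: (4 - p) / 6; 0; 0]).
    by apply/quadric_coneP; rewrite mulr0 expr0n.
  rewrite poly_map_astroid_of_cone; congr (vec 4 [:: _; _; _; _]).
  - by field.
  - by rewrite mulr0.
  - by ring.
  apply/eqP; rewrite -subr_eq0; apply/eqP.
  by rewrite -[RHS](mulr0 108^-1) -[in RHS]A0; field.
have [|y [uE DE]] := @cuspidal_cubic_parameter p q r q0.
  (* Adding [108 (q s - r^2)] to [q A_h] eliminates [s]. *)
  transitivity (q * 0 + 108 * (q * s - r ^+ 2)); last first.
    by rewrite qs subrr !mulr0 addr0.
  by rewrite -[in RHS]A0; ring.
have cone : quadric_cone K (vec 3 [:: q / 2 * y ^+ 2; q / 2 * y; q / 2]).
  by apply/quadric_coneP; field.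
exists (vec 3 [:: q / 2 * y ^+ 2; q / 2 * y; q / 2]) => //.
(* The last coordinate needs no computation: the image lies on the surface, so [q s' = r^2 = q s],
   and [q] cancels. *)
have := astroid_of_cone_surface cone.
rewrite poly_map_astroid_of_cone => /astroid_surfaceP[_].
set p' := 4 - _ - _; set q' := 2 * _; set r' := _ + 4 * (q / 2).
set s' := _ + 8 * (q / 2).
have -> : p' = p by rewrite -[RHS](subKr 4) uE /p'; field.
have -> : q' = q by rewrite /q'; field.
have -> : r' = r by rewrite -[RHS](subrK (2 * q)) DE /r'; field.
by rewrite -qs => /(mulfI q0) ->.
Qed.

(** The last hypothesis is the pullback of [q + 3 u != 0]. Substituting [a = b^2 / c] turns that
    form into [2 (c + 3 b)^2 / c], so only the line over the cusp is excluded. *)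
Lemma cone_of_astroidK (a b c : K) :
    a * c = b ^+ 2 -> c != 0 -> 2 * c + 18 * a + 12 * b != 0 ->
  map_value (cone_of_astroid K) (poly_map (astroid_of_cone K) (vec 3 [:: a; b; c])) =
  vec 3 [:: a; b; c].
Proof.
move=> cone c0.
have -> : a = b ^+ 2 / c by rewrite -cone mulfK.
have -> : 2 * c + 18 * (b ^+ 2 / c) + 12 * b = 2 * (c + 3 * b) ^+ 2 / c by field.
move=> NE0; have N0 : c + 3 * b != 0.
  by apply: contraNneq NE0 => ->; rewrite expr0n mulr0 mul0r.
rewrite poly_map_astroid_of_cone map_value_cone_of_astroid /=.
have NE : 2 * c + 12 - 3 * (4 - 6 * (b ^+ 2 / c) - 4 * b)
  = 2 * (c + 3 * b) ^+ 2 / c by field.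
by congr (vec 3 [:: _; _; _]); rewrite ?NE; field; rewrite ?c0 ?N0.
Qed.

Lemma cone_of_astroid_defined (p q r s : K) :
  map_defined (cone_of_astroid K) (vec 4 [:: p; q; r; s]) <->
  q != 0 /\ q + 12 - 3 * p != 0.
Proof.
split=> [def|[q0 N0]].
  have := def 0; rewrite /fraction_defined /tnth /= !meval_simp /= => /eqP.
  by rewrite mulf_eq0 mulf_eq0 sqrf_eq0 !negb_or => /andP[/andP[_ ->]].
by move=> -[[|[|[|i]]] //= lti]; rewrite /fraction_defined /tnth /= !meval_simp /=;
  apply/eqP; rewrite ?mulf_neq0 ?expf_neq0 ?pnatr_eq0.
Qed.

Lemma cone_of_astroid_cone (x : K ^ 4) :
    map_defined (cone_of_astroid K) x ->
  quadric_cone K (map_value (cone_of_astroid K) x).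
Proof.
rewrite [x]vec4P => /cone_of_astroid_defined[q0 N0].
by rewrite map_value_cone_of_astroid; apply/quadric_coneP; field; rewrite q0 N0.
Qed.

End Birational.

(** * Irreducibility of the cone and birational equivalence *)

Lemma irreducible_quadric_cone (K : numClosedFieldType) :
  irreducible_variety (quadric_cone K).
Proof.
apply: (irreducible_image (l := squares K) (irreducible_affine_space K 2)).
- exact: algebraic_zero_locus.
- by move=> y _; rewrite poly_map_squares; apply/quadric_coneP; ring.
move=> x; rewrite [x]vec3P; move: (x 0) (x 1) (x 2) => a b c /quadric_coneP cone.
suff [v [w [<- <- <-]]] : exists v w, [/\ v ^+ 2 = a, v * w = b & w ^+ 2 = c].
  by exists (vec 2 [:: v; w]) => //; rewrite poly_map_squares !ffunE.
have [a0|a0] := eqVneq a 0.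
  exists 0, (sqrtC c); rewrite sqrtCK expr0n mul0r a0; split=> //.
  by apply/esym/eqP; rewrite -sqrf_eq0 -cone a0 mul0r.
(* Only one root is chosen freely; taking [w = b / v] gives it the sign that [v * w = b]
   requires. *)
have v0 : sqrtC a != 0 by rewrite sqrtC_eq0.
exists (sqrtC a), (b / sqrtC a); split; first exact: sqrtCK.
  by rewrite mulrC divfK.
by rewrite expr_div_n sqrtCK -cone mulrC mulKf.
Qed.

Lemma birational_astroid_cone (K : numClosedFieldType) :
  birationally_equivalent (astroid_surface K) (quadric_cone K).
Proof.
(* The inverse is defined where [f] is nonzero, and [f] pulls back to [2 g], so [f] and [g] cut out
   matching open sets. *)
pose g : {mpoly K[3]} := 'X_(2 : 'I_3) *
  (2 * 'X_(2 : 'I_3) + 18 * 'X_(0 : 'I_3) + 12 * 'X_(1 : 'I_3)).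
pose f : {mpoly K[4]} := 'X_(1 : 'I_4) * ('X_(1 : 'I_4) + 12 - 3 * 'X_(0 : 'I_4)).
have gE (a b c : K) : g.@[vec 3 [:: a; b; c]] = c * (2 * c + 18 * a + 12 * b).
  by rewrite /g !meval_simp.
have fE (p q r s : K) : f.@[vec 4 [:: p; q; r; s]] = q * (q + 12 - 3 * p).
  by rewrite /f !meval_simp.
have fgE (y : K ^ 3) : f.@[poly_map (astroid_of_cone K) y] = 2 * g.@[y].
  rewrite [y]vec3P; move: (y 0) (y 1) (y 2) => a b c.
  by rewrite poly_map_astroid_of_cone fE gE; ring.
have fdef (x : K ^ 4) : f.@[x] != 0 -> map_defined (cone_of_astroid K) x.
  rewrite [x]vec4P; move: (x 0) (x 1) (x 2) (x 3) => p q r s.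
  by rewrite fE mulf_eq0 negb_or => /andP[? ?]; apply/cone_of_astroid_defined.
have gK (y : K ^ 3) : quadric_cone K y -> g.@[y] != 0 ->
    map_value (cone_of_astroid K) (poly_map (astroid_of_cone K) y) = y.
  rewrite [y]vec3P; move: (y 0) (y 1) (y 2) => a b c /quadric_coneP cone.
  by rewrite gE mulf_eq0 negb_or => /andP[]; apply: cone_of_astroidK.
pose y1 : K ^ 3 := vec 3 [:: 1; 1; 1].
have cone1 : quadric_cone K y1 by apply/quadric_coneP; rewrite mulr1 expr1n.
have g1 : g.@[y1] != 0 by rewrite gE !mulr1 -!natrD mul1r pnatr_eq0.
have surf1 := astroid_of_cone_surface cone1.
have f1 : f.@[poly_map (astroid_of_cone K) y1] != 0.
  by rewrite fgE mulf_neq0 ?pnatr_eq0.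
have irrC := irreducible_quadric_cone K.
split=> //.
  apply: (irreducible_image irrC (l := astroid_of_cone K)); first exact: algebraic_zero_locus.
    exact: astroid_of_cone_surface.
  exact: astroid_of_cone_onto.
exists (cone_of_astroid K), (poly_fractions (astroid_of_cone K)); split.
- split=> [|x _]; last exact: cone_of_astroid_cone.
  by apply: (generically_neq0 surf1 f1) => x _; apply: fdef.
- split=> [|y Vy _]; last first.
    by rewrite map_value_poly_fractions; apply: astroid_of_cone_surface.
  by apply: (generically_neq0 cone1 g1) => y _ _; apply: map_defined_poly_fractions.
- apply: (generically_neq0 surf1 f1) => x surf fx; split.
  + exact: fdef.
  + exact: map_defined_poly_fractions.
  (* Each surface point is the image of a cone point, so this composite reduces to the one already
     known on the cone. *)
  case: (astroid_of_cone_onto surf) fx => y cone <-.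
  rewrite fgE mulf_eq0 negb_or map_value_poly_fractions => /andP[_ gy].
  by rewrite gK.
- apply: (generically_neq0 cone1 g1) => y cone gy.
  rewrite map_value_poly_fractions; split; last exact: gK.
    exact: map_defined_poly_fractions.
  by apply: fdef; rewrite fgE mulf_neq0 ?pnatr_eq0.
Qed.

Theorem proposition4p24 (R : realType) :
  birationally_equivalent (astroid_surface R[i]%C) (quadric_cone R[i]%C).
Proof. exact: birational_astroid_cone. Qed.
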